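(* Let $X$ be a finite $T_0$-space and let $\{X_p : p\in\mathbb{Z}\}$ be a filtration of $X$ which is induced by antichains. For each $p\in\mathbb{N}$ let $D_p=X_p-X_{p-1}$. Then there is a spectral sequence $\{(E^r_{p,q})_{p,q\in\mathbb{Z}},(d^r_{p,q})_{p,q\in\mathbb{Z}}\}_{r\in\mathbb{N}}$ that converges to $H_*(X)$ such that: \begin{itemize} \item $E^1_{p,q}=0$ for every $p\leq -1$; \item $E^1_{0,q}=H_q(X_0)$; \item $E^1_{p,q}=\bigoplus_{x\in D_p}\tilde{H}_{p+q-1}(\hat{C}^{X_p}_x)$ for $p\geq 1$; \item the morphisms $d^1_{p,q}:E^1_{p,q}\to E^1_{p-1,q}$ are as follows: \begin{itemize} \item if $p\leq 0$ and $q\in\mathbb{Z}$, then $d^1_{p,q}$ is trivial; \item if $p=1$ and $q\in\mathbb{N}_0$, then $d^1_{1,q}:\bigoplus_{x\in D_1}\tilde{H}_q(\hat{C}^{X_1}_x)\to H_q(X_0)$ is given by $d^1_{1,q}(([\sigma_x])_{x\in D_1})=\sum_{x\in D_1}[\sigma_x]$; \item if $p\geq 1$ and $q\leq -p$, then $d^1_{p,q}$ is trivial; \item if $p\geq 2$ and $q\geq 1-p$, then $d^1_{p,q}:\bigoplus_{x\in D_p}\tilde{H}_{p+q-1}(\hat{C}^{X_p}_x)\to\bigoplus_{y\in D_{p-1}}\tilde{H}_{p+q-2}(\hat{C}^{X_{p-1}}_y)$ is given by $$d^1_{p,q}\left(\left(\left[\sum_{i=1}^{l_x}a^x_i s^x_i\right]\right)_{x\in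 D_p}\right)=\left(\left[\sum_{x\in D_p}\ \sum_{i\,:\,y\in s^x_i}a^x_i\,\mathrm{sgn}_{s^x_i}(y)\,(s^x_i-\{y\})\right]\right)_{y\in D_{p-1}},$$ where for every $x\in D_p$, $l_x\in\mathbb{N}$ and, for every $i\in\{1,\dots,l_x\}$, $a^x_i\in\mathbb{Z}$ and $s^x_i$ is a $(p+q-1)$-chain of $\hat{C}^{X_p}_x$ (the sum $\sum_i a^x_is^x_i$ being a cycle). \end{itemize} \end{itemize}
   Context: $\mathbb{N}=\{1,2,\dots\}$, $\mathbb{N}_0=\mathbb{N}\cup\{0\}$. A finite $T_0$-space is identified with a finite poset: the open sets are the down-sets. For a poset $Y$ and $x\in Y$: $U_x^Y=\{a\in Y: a\leq x\}$, $F_x^Y=\{a\in Y: a\geq x\}$, $C_x^Y=U_x^Y\cup F_x^Y$, $\hat C_x^Y=C_x^Y-\{x\}$. An $n$-chain of a poset $Y$ is a chain (totally ordered subset) of cardinality $n+1$; the empty chain is a $(-1)$-chain. Write $[v_0,\dots,v_n]$ for the chain with $v_0<\dots<v_n$. The homology $H_*(Y)$ is identified with the homology of the chain complex $C^f(Y)$ in which $C^f_n(Y)$ is the free abelian group on the $n$-chains of $Y$ ($n\ge 0$), with $d^f_n[v_0,\dots,v_n]=\sum_{i=0}^n(-1)^i[v_0,\dots,\hat{v_i},\dots,v_n]$ (this is the simplicial chain complex of the order complex of $Y$). Reduced homology $\tilde H_*(Y)$ is computed by the augmented complex having the free abelian group on the empty chain in degree $-1$; thus $\tilde H_{-1}(\varnothing)=\mathbb{Z}$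 and $\tilde H_n(\varnothing)=0$ for $n\neq -1$. $[\sigma]$ denotes the homology class of a cycle $\sigma$. For a chain $s=[y_0,\dots,y_n]$ and $y=y_k\in s$, the sign of $y$ in $s$ is $\mathrm{sgn}_s(y)=(-1)^k$. A filtration $\{X_p:p\in\mathbb{Z}\}$ of $X$ is a family of subspaces (subposets) with $X_p\subseteq X_{p+1}$ for all $p$ and $\bigcup_pX_p=X$. It is induced by antichains if $X_{-1}=\varnothing$ and $X_n-X_{n-1}$ is an antichain for every $n\in\mathbb{N}$ ($X_0$ need not be an antichain). *)

(* Defs.v *)
From HB Require Import structures.
From mathcomp Require Import all_boot all_order all_algebra.
From mathcomp Require Import boolp.
Set Implicit Arguments.
Unset Strict Implicit.
Unset Printing Implicit Defensive.
Import Order.TTheory GRing.Theory Num.Theory.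
Local Open Scope ring_scope.

Section Subquotient.
Variables (A : zmodType) (Z B : zmodClosed A).

Record subgrp := Subgrp { subgrp_val : A; _ : subgrp_val \in Z }.
HB.instance Definition _ := [isSub for subgrp_val].
HB.instance Definition _ := [Choice of subgrp by <:].
HB.instance Definition _ := [SubChoice_isSubZmodule of subgrp by <:].

Definition subquot_pred : {pred subgrp} := fun z => val z \in B.

Fact subquot_pred_closed : zmod_closed subquot_pred.
Proof.
split=> [|x y xB yB]; first exact: (rpred0 B).
by rewrite /in_mem /= /subquot_pred raddfB; exact: rpredB.
Qed.
HB.instance Definition _ :=
  GRing.isZmodClosed.Build subgrp subquot_pred subquot_pred_closed.

(* Z / (Z :&: B) *)
Definition subquot : zmodType := {ideal_quot subquot_pred}.

Definition subquot_class (z : subgrp) : subquot :=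
  (\pi_{ideal_quot subquot_pred} z)%qT.
End Subquotient.

Section KernelImage.
Variables (A B : zmodType) (f : {additive A -> B}).

Definition ker_pred : {pred A} := fun a => f a == 0.
(* Membership in an image is made boolean by excluded middle. *)
Definition im_pred : {pred B} := fun b => `[< exists a, f a = b >].

Fact ker_pred_closed : zmod_closed ker_pred.
Proof.
split=> [|x y]; rewrite !unfold_in /ker_pred ?raddf0 // raddfB.
by move=> /eqP-> /eqP->; rewrite subrr.
Qed.
HB.instance Definition _ := GRing.isZmodClosed.Build A ker_pred ker_pred_closed.

Fact im_pred_closed : zmod_closed im_pred.
Proof.
split=> [|x y]; rewrite !unfold_in /im_pred.
  by apply/asboolP; exists 0; rewrite raddf0.
move=> /asboolP[a <-] /asboolP[b <-].
by apply/asboolP; exists (a - b); rewrite raddfB.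
Qed.
HB.instance Definition _ := GRing.isZmodClosed.Build B im_pred im_pred_closed.
End KernelImage.

Definition cycles (B C : zmodType) (g : {additive B -> C}) : zmodType :=
  subgrp (ker_pred g).

Definition homology (A B C : zmodType)
    (f : {additive A -> B}) (g : {additive B -> C}) : zmodType :=
  subquot (ker_pred g) (im_pred f).

Definition hclass (A B C : zmodType)
    (f : {additive A -> B}) (g : {additive B -> C}) (z : cycles g) :
  homology f g := subquot_class (im_pred f) z.

Definition isomorphic (A B : zmodType) : Prop :=
  exists f : {additive A -> B}, bijective f.

Section DirectSum.
Variables (I : finType) (A : I -> zmodType).

Definition dffun_zero : {dffun forall i, A i} := [ffun i => 0 : A i].
Definition dffun_opp (f : {dffun forall i, A i}) : {dffun forall i, A i} :=
  [ffun i => - f i : A i].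
Definition dffun_add (f g : {dffun forall i, A i}) : {dffun forall i, A i} :=
  [ffun i => f i + g i : A i].

Fact dffun_addA : associative dffun_add.
Proof. by move=> f g h; apply/ffunP=> i; rewrite !ffunE addrA. Qed.
Fact dffun_addC : commutative dffun_add.
Proof. by move=> f g; apply/ffunP=> i; rewrite !ffunE addrC. Qed.
Fact dffun_add0 : left_id dffun_zero dffun_add.
Proof. by move=> f; apply/ffunP=> i; rewrite !ffunE add0r. Qed.
Fact dffun_addN : left_inverse dffun_zero dffun_opp dffun_add.
Proof. by move=> f; apply/ffunP=> i; rewrite !ffunE addNr. Qed.
HB.instance Definition _ := GRing.isZmodule.Build {dffun forall i, A i}
  dffun_addA dffun_addC dffun_add0 dffun_addN.

(* The index set is finite, so the direct sum is the direct product. *)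
Definition dsum : zmodType := {dffun forall i, A i}.
Definition dsum_coord (u : dsum) (i : I) : A i := (u : {dffun forall i, A i}) i.
End DirectSum.

Section Posets.
Variables (disp : Order.disp_t) (T : finPOrderType disp).
Implicit Types (Y s : {set T}) (x y : T) (m n p : int) (aug : bool).

Definition Uset Y x : {set T} := [set a in Y | (a <= x)%O].
Definition Fset Y x : {set T} := [set a in Y | (x <= a)%O].
Definition Cset Y x : {set T} := Uset Y x :|: Fset Y x.
Definition Chat Y x : {set T} := Cset Y x :\ x.

Definition is_chain s : bool := [forall x in s, forall y in s, (x >=< y)%O].
Definition is_antichain s : bool :=
  [forall x in s, forall y in s, (x <= y)%O ==> (x == y)].

Definition nchain Y n s : bool :=
  [&& s \subset Y, is_chain s & #|s|%:Z == n + 1].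

(* If s = [y_0, ..., y_n] and y = y_k, then k elements of s lie below y. *)
Definition sgn s y : int := (-1) ^+ #|[set z in s | (z < y)%O]|.

Definition is_filtration (X : int -> {set T}) : Prop :=
  (forall p, X p \subset X (p + 1)) /\ (forall x, exists p, x \in X p).

Definition stratum (X : int -> {set T}) p : {set T} := X p :\: X (p - 1).

Definition induced_by_antichains (X : int -> {set T}) : Prop :=
  X (-1) = set0 /\ forall n, 1 <= n -> is_antichain (stratum X n).

Fact nchainD1 Y n s y : nchain Y n s -> y \in s -> nchain Y (n - 1) (s :\ y).
Proof.
case/and3P=> sY ch /eqP eqn ys; apply/and3P; split.
- exact: subset_trans (subD1set _ _) sY.
- apply/forall_inP=> a /setD1P[_ aS]; apply/forall_inP=> b /setD1P[_ bS].
  by move/forall_inP: ch => /(_ a aS)/forall_inP/(_ b bS).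
- rewrite subrK; apply/eqP/(addrI 1); rewrite [RHS]addrC -eqn.
  by rewrite (cardsD1 y s) ys.
Qed.

Fact Chat_stratum (X : int -> {set T}) p x :
  induced_by_antichains X -> 1 <= p -> x \in stratum X p ->
  Chat (X p) x \subset X (p - 1).
Proof.
case=> _ /(_ p) + p1 xD => /(_ p1) /forall_inP anti.
apply/subsetP=> y /setD1P[yx yC].
have yX : y \in X p by move: yC; rewrite !inE => /orP[] /andP[].
apply: contraNT yx => yX1.
have yD : y \in stratum X p by rewrite inE yX1 yX.
move: yC; rewrite !inE yX /= => /orP[yx|xy].
  by move/forall_inP: (anti y yD) => /(_ x xD); rewrite yx.
by move/forall_inP: (anti x xD) => /(_ y yD); rewrite xy eq_sym.
Qed.

Fact nchain_stratum (X : int -> {set T}) p n s x y :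
  induced_by_antichains X -> 1 <= p -> x \in stratum X p ->
  nchain (Chat (X p) x) n s -> y \in s ->
  nchain (Chat (X (p - 1)) y) (n - 1) (s :\ y).
Proof.
move=> HA p1 xD ns ys; have /and3P[sC ch _] := ns.
have /and3P[_ ch' c'] := nchainD1 ns ys; apply/and3P; split=> //.
apply/subsetP=> z; rewrite in_setD1 => /andP[zy zs].
have zX := subsetP (Chat_stratum HA p1 xD) _ (subsetP sC _ zs).
move/forall_inP: ch => /(_ z zs)/forall_inP/(_ y ys).
by rewrite /Order.comparable !inE zy zX.
Qed.

(* Generators in degree n of the chain complex C^f(Y) (aug = false) or of its
   augmentation by the empty chain in degree -1 (aug = true). *)
Definition gens aug Y n :=
  {s : {set T} | nchain Y n s && (aug || (0 <= n))}.

Definition chains aug Y n : zmodType := {ffun gens aug Y n -> int}.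

(* The generator s, or 0 if s is not a generator in degree n of the complex of
   Y. The second case occurs in this development only for n = -1, s = set0 and
   aug = false: see nchainD1, Chat_stratum and nchain_stratum. *)
Definition gen aug Y n s : chains aug Y n := [ffun t => (val t == s)%:R].

(* The source and target degrees m and n are independent, which avoids casts
   along equations between integers; only n = m - 1 is meaningful. *)
Definition bd_fun aug Y m n (c : chains aug Y m) : chains aug Y n :=
  \sum_(s : gens aug Y m) \sum_(v in val s)
    gen aug Y n (val s :\ v) *~ ((c : {ffun _}) s * sgn (val s) v).

Fact bd_is_zmod_morphism aug Y m n : zmod_morphism (@bd_fun aug Y m n).
Proof.
move=> c c'; rewrite /bd_fun -sumrB; apply: eq_bigr => s _.
rewrite -sumrB; apply: eq_bigr => v _.
by rewrite !ffunE mulrBl mulrzBr.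
Qed.
HB.instance Definition _ aug Y m n :=
  GRing.isZmodMorphism.Build (chains aug Y m) (chains aug Y n)
    (@bd_fun aug Y m n) (@bd_is_zmod_morphism aug Y m n).

Definition bd aug Y m n : {additive chains aug Y m -> chains aug Y n} :=
  @bd_fun aug Y m n.

Definition cyc aug Y n : zmodType := cycles (bd aug Y n (n - 1)).

Definition chain_homology aug Y n : zmodType :=
  homology (bd aug Y (n + 1) n) (bd aug Y n (n - 1)).

Definition class aug Y n (z : cyc aug Y n) : chain_homology aug Y n :=
  hclass (bd aug Y (n + 1) n) z.

(* A cycle as an element of the chain group. *)
Definition cyc_val aug Y n (z : cyc aug Y n) : chains aug Y n :=
  val (z : subgrp (ker_pred (bd aug Y n (n - 1)))).

(* A chain of Y regarded as a chain of Y', as when Y is a subset of Y'. *)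
Definition push aug Y n aug' Y' n' (c : chains aug Y n) : chains aug' Y' n' :=
  \sum_(s : gens aug Y n) gen aug' Y' n' (val s) *~ (c : {ffun _}) s.
End Posets.

Notation Hf := (chain_homology false).
Notation Hred := (chain_homology true).

Fact in_p (r : nat) (p : int) : p = p + r%:Z - r%:Z.
Proof. by rewrite addrK. Qed.
Fact in_q (r : nat) (q : int) : q = q - r%:Z + 1 + r%:Z - 1.
Proof. by rewrite [q - _ + 1]addrAC addrNK addrK. Qed.

(* Only the pages r >= 1 are meaningful. The target bidegree of a differential
   is a variable subject to equations, which avoids casts. *)
Record spectral_sequence := SpectralSequence {
  page : nat -> int -> int -> zmodType;
  diff : forall (r : nat) (p q p' q' : int),
    p' = p - r%:Z -> q' = q + r%:Z - 1 ->
    {additive page r p q -> page r p' q'};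
  diff_out := fun (r : nat) (p q : int) =>
    diff (erefl (p - r%:Z)) (erefl (q + r%:Z - 1));
  diff_in := fun (r : nat) (p q : int) =>
    diff (in_p r p) (in_q r q);
  diff_diff : forall (r : nat) (p q : int), (0 < r)%N ->
    forall u, diff_out r p q (diff_in r p q u) = 0;
  turn : forall (r : nat) (p q : int),
    {additive homology (diff_in r p q) (diff_out r p q) -> page r.+1 p q};
  turn_bij : forall (r : nat) (p q : int), (0 < r)%N -> bijective (turn r p q)
}.

(* Convergence with respect to a finite filtration G of each H_n: near every
   (p, q) the sequence is eventually stationary, and the stable value, that is
   E^oo_{p,q}, is isomorphic to G_p H_{p+q} / G_{p-1} H_{p+q}. *)
Definition converges_to (S : spectral_sequence) (Hs : int -> zmodType) : Prop :=
  exists G : forall n : int, int -> zmodClosed (Hs n),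
  [/\ forall (n p : int) (x : Hs n), x \in G n p -> x \in G n (p + 1),
      forall n : int, exists p : int, forall x : Hs n, x \in G n p -> x = 0,
      forall n : int, exists p : int, forall x : Hs n, x \in G n p &
      forall p q : int, exists2 r0 : nat, (0 < r0)%N &
        forall r : nat, (r0 <= r)%N ->
        [/\ forall u, diff_out S r p q u = 0,
            forall u, diff_in S r p q u = 0 &
            isomorphic (page S r p q)
              (subquot (G (p + q) p) (G (p + q) (p - 1)))]].

(* Main.v *)
Require Import Defs.
From HB Require Import structures.
From mathcomp Require Import all_boot all_order all_algebra.
From mathcomp Require Import boolp.
From mathcomp Require Import zify.
Set Implicit Arguments.
Unset Strict Implicit.
Unset Printing Implicit Defensive.
Import Order.TTheory GRing.Theory Num.Theory.
Local Open Scope ring_scope.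

(** The spectral sequence is that of the simplicial chain complex of the order
    complex of X, filtered by the chains that lie in X_p; since the filtration
    is finite it converges to the homology of X. For any filtered complex
      E^r_p = Z^r_p / (Z^r_p :&: (F_(p-1) + d F_(p+r-1))),
    where Z^r_p consists of the c in F_p with d c in F_(p-r), and d^r sends the
    class of c to the class of d c ([filtered_ss], [filtered_ss_converges]).

    Everything specific to posets happens on the first page, where E^1_p is the
    homology of F_p / F_(p-1). As X_p - X_(p-1) is an antichain D, a chain of
    X_p that does not lie in X_(p-1) contains exactly one x in D, and it is x
    inserted in a chain of the punctured star of x. So, up to sign,
    F_p / F_(p-1) is the direct sum over x in D of the augmented complexes of
    the punctured stars, with degrees shifted by one: a chain s containing x
    corresponds to sgn_s(x) (s - x). The map [link] reads off the coordinate at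
    x and [cone] puts x back. They anticommute with the boundaries, except that
    the boundary of a cone also contains its base:
      d (link c) = - link (d c)   and   d (cone c) = c - cone (d c)
    ([bd_link], [bd_cone]), and c minus the sum of cone_x (link_x c) lies in
    F_(p-1) ([sub_tcone_supp]). Hence [link] induces the isomorphism of E^1_p
    with the sum of the reduced homologies ([theta_exists]).

    The formula for d^1 comes from choosing representatives well. A family of
    cycles sigma_x in the punctured stars is represented in Z^1_p by the sum of
    the cones over the sigma_x, whose boundary is simply the sum of the sigma_x
    ([bd_tcone_cycles]). For p = 1 this is the value of d^1; for p > 1 one
    applies [link] at each y in X_(p-1) - X_(p-2), and the terms
    sgn_s(y) (s - y) appear. *)

(** * Maps out of subquotients *)

Section Subquotients.
Variables (A : zmodType) (Z B : zmodClosed A).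
Implicit Types z : subgrp Z.

Lemma subquot_class_is_zmod_morphism :
  zmod_morphism (subquot_class B : subgrp Z -> subquot Z B).
Proof. by move=> x y; rewrite /subquot_class raddfB. Qed.
HB.instance Definition _ := GRing.isZmodMorphism.Build (subgrp Z) (subquot Z B)
  (subquot_class B) subquot_class_is_zmod_morphism.

Lemma subquot_class_surj (u : subquot Z B) : exists z, u = subquot_class B z.
Proof. by exists (repr u); rewrite /subquot_class reprK. Qed.

Lemma subquot_class_eq z z' :
  subquot_class B z = subquot_class B z' <-> val z - val z' \in B.
Proof.
have <- : (z - z' \in subquot_pred B) = (val z - val z' \in B).
  by rewrite {1}/in_mem /= /subquot_pred raddfB.
by rewrite Quotient.idealrBE; split=> /eqP.
Qed.

Lemma subquot_class_eq0 z : subquot_class B z = 0 <-> val z \in B.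
Proof.
by have := subquot_class_eq z 0; rewrite raddf0 (_ : val 0 = 0) ?subr0.
Qed.

Lemma corestr_subproof (A' : zmodType) (g : {additive A' -> A})
  (gZ : forall a, g a \in Z) : zmod_morphism (fun a => Subgrp (gZ a)).
Proof. by move=> x y; apply/val_inj; rewrite /= raddfB. Qed.

Definition corestr (A' : zmodType) (g : {additive A' -> A})
  (gZ : forall a, g a \in Z) : A' -> subgrp Z := fun a => Subgrp (gZ a).
HB.instance Definition _ A' g gZ :=
  GRing.isZmodMorphism.Build A' (subgrp Z) (@corestr A' g gZ)
    (corestr_subproof gZ).

Variables (M : zmodType) (f : {additive subgrp Z -> M}).

Section Lift.
Hypothesis f0 : forall z, val z \in B -> f z = 0.

Definition subquot_lift_fun (u : subquot Z B) : M := f (repr u).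

Lemma subquot_lift_funE z : subquot_lift_fun (subquot_class B z) = f z.
Proof.
apply/eqP; rewrite -subr_eq0 /subquot_lift_fun -raddfB; apply/eqP/f0.
by rewrite raddfB; apply/subquot_class_eq; rewrite /subquot_class reprK.
Qed.

Lemma subquot_lift_is_zmod_morphism : zmod_morphism subquot_lift_fun.
Proof.
move=> u v; have [x ->] := subquot_class_surj u.
have [y ->] := subquot_class_surj v.
by rewrite -raddfB !subquot_lift_funE raddfB.
Qed.

Lemma subquot_lift_exists :
  exists g : {additive subquot Z B -> M}, forall z, g (subquot_class B z) = f z.
Proof.
pose h := GRing.isZmodMorphism.Build (subquot Z B) M subquot_lift_fun
  subquot_lift_is_zmod_morphism.
pose g : {additive subquot Z B -> M} := HB.pack subquot_lift_fun h.
by exists g => z; apply: subquot_lift_funE.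
Qed.
Definition subquot_lift : {additive subquot Z B -> M} :=
  sval (cid subquot_lift_exists).

Lemma subquot_liftE z : subquot_lift (subquot_class B z) = f z.
Proof. exact: (svalP (cid subquot_lift_exists)). Qed.
End Lift.

Lemma subquot_lift_bij (f0 : forall z, val z \in B -> f z = 0) :
  (forall z, f z = 0 -> val z \in B) -> (forall m, exists z, f z = m) ->
  bijective (subquot_lift f0).
Proof.
move=> finj fsurj; pose g m := subquot_class B (sval (cid (fsurj m))).
exists g => [u|m]; last by rewrite subquot_liftE; case: cid.
have [z ->] := subquot_class_surj u; apply/subquot_class_eq.
rewrite -raddfB; apply: finj; rewrite raddfB; case: cid => z' /= ->.
by rewrite subquot_liftE subrr.
Qed.
End Subquotients.

Lemma isomorphic_sym (A B : zmodType) : isomorphic A B -> isomorphic B A.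
Proof.
case=> f [g fK gK].
pose h := GRing.isZmodMorphism.Build B A g (can2_zmod_morphism fK gK).
pose g' : {additive B -> A} := HB.pack g h.
by exists g', f.
Qed.

Section DirectSumMap.
Variables (I : finType) (A : I -> zmodType) (M : zmodType).
Variable f : forall i, {additive M -> A i}.

Definition dsum_map (m : M) : dsum A := [ffun i => f i m : A i].

Lemma dsum_mapE m i : dsum_coord (dsum_map m) i = f i m.
Proof. by rewrite /dsum_coord /dsum_map ffunE. Qed.

Lemma dsum_ext (u v : dsum A) :
  (forall i, dsum_coord u i = dsum_coord v i) -> u = v.
Proof. by move=> E; apply/ffunP. Qed.

Lemma dsum_map_is_zmod_morphism : zmod_morphism dsum_map.
Proof.
by move=> x y; apply: dsum_ext => i; rewrite /dsum_coord !ffunE raddfB.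
Qed.
HB.instance Definition _ :=
  GRing.isZmodMorphism.Build M (dsum A) dsum_map dsum_map_is_zmod_morphism.
End DirectSumMap.

(** * The spectral sequence of a filtered complex *)

Section FilteredComplex.
Variables (C : int -> zmodType) (d : forall m n, {additive C m -> C n}).
Variable F : int -> forall n, zmodClosed (C n).

Definition rcycle (r : nat) (p n : int) : {pred C n} :=
  fun c => (c \in F p n) && (d n (n - 1) c \in F (p - r%:Z) (n - 1)).
Arguments rcycle : clear implicits.

(** The textbook denominator of E^r_p is Z^(r-1)_(p-1) + d Z^(r-1)_(p+r-1). Its
    elements are exactly the r-cycles that lie in F_(p-1) + d F_(p+r-1): if
    c = a + d b is an r-cycle, with a in F_(p-1) and b in F_(p+r-1), then
    d b = c - a is in F_p and d a = d c is in F_(p-r). This form makes the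
    verifications below shorter. *)
Definition rboundary (r : nat) (p n : int) : {pred C n} := fun c =>
  `[< exists a b, [/\ a \in F (p - 1) n, b \in F (p + r%:Z - 1) (n + 1)
                    & c = a + d (n + 1) n b] >].
Arguments rboundary : clear implicits.

Fact rcycle_closed r p n : zmod_closed (rcycle r p n).
Proof.
split=> [|x y]; first by apply/andP; rewrite raddf0 !rpred0.
by move=> /andP[xF dx] /andP[yF dy]; apply/andP; rewrite raddfB !rpredB.
Qed.
HB.instance Definition _ r p n :=
  GRing.isZmodClosed.Build (C n) (rcycle r p n) (rcycle_closed r p n).

Fact rboundary_closed r p n : zmod_closed (rboundary r p n).
Proof.
split=> [|x y].
  by apply/asboolP; exists 0, 0; rewrite raddf0 addr0 !rpred0.
move=> /asboolP[a [b [aF bF ->]]] /asboolP[a' [b' [aF' bF' ->]]].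
apply/asboolP; exists (a - a'), (b - b'); rewrite !rpredB //.
by rewrite raddfB opprD addrACA.
Qed.
HB.instance Definition _ r p n :=
  GRing.isZmodClosed.Build (C n) (rboundary r p n) (rboundary_closed r p n).

Lemma rcycleP r p n n' c : n' = n - 1 ->
  reflect (c \in F p n /\ d n n' c \in F (p - r%:Z) n') (c \in rcycle r p n).
Proof. by move=> ->; apply: (iffP andP). Qed.

Lemma rboundaryP r p n m c : m = n + 1 ->
  reflect (exists a b, [/\ a \in F (p - 1) n, b \in F (p + r%:Z - 1) m
                    & c = a + d m n b]) (c \in rboundary r p n).
Proof. by move=> ->; apply: (iffP (asboolP _)). Qed.

Definition Epage r p q : zmodType :=
  subquot (rcycle r p (p + q)) (rboundary r p (p + q)).

Hypothesis dd : forall m n k : int, n = m - 1 -> k = n - 1 ->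
  forall c, d n k (d m n c) = 0.
Hypothesis Fmono : forall (p p' n : int) c,
  p <= p' -> c \in F p n -> c \in F p' n.

Section Differential.
Variables (r : nat) (p q p' q' : int).
Hypotheses (Hp : p' = p - r%:Z) (Hq : q' = q + r%:Z - 1).

Let Hn : p' + q' = p + q - 1. Proof. lia. Qed.

Lemma d_rcycle (z : subgrp (rcycle r p (p + q))) :
  d (p + q) (p' + q') (val z) \in rcycle r p' (p' + q').
Proof.
have /(rcycleP r p _ Hn)[_] := valP z; rewrite -Hp => dz.
by apply/(rcycleP _ _ _ erefl); rewrite dd // rpred0.
Qed.

Definition drcycle : {additive subgrp (rcycle r p (p + q)) ->
                       subgrp (rcycle r p' (p' + q'))} :=
  corestr (g := (d (p + q) (p' + q') \o val)) d_rcycle.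

Lemma val_drcycle z : val (drcycle z) = d (p + q) (p' + q') (val z).
Proof. by []. Qed.

(** If c = a + d b with a in F_(p-1), then d c = d a, and p - 1 = (p-r) + r - 1
    makes d a an r-boundary in filtration degree p - r. *)
Lemma d_rboundary (z : subgrp (rcycle r p (p + q))) :
  val z \in rboundary r p (p + q) ->
  (subquot_class (rboundary r p' (p' + q')) \o drcycle) z = 0.
Proof.
case/(rboundaryP r p _ erefl)=> a [b [aF bF zE]]; apply/subquot_class_eq0.
have Hm : p + q = p' + q' + 1 by rewrite Hn subrK.
apply/(rboundaryP _ _ _ Hm); exists 0, a; split; first exact: rpred0.
  by rewrite (_ : p' + r%:Z - 1 = p - 1) // Hp subrK.
by rewrite /= zE raddfD dd ?addrK // addr0 add0r.
Qed.

Definition Ediff : {additive Epage r p q -> Epage r p' q'} :=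
  subquot_lift d_rboundary.

Lemma EdiffE z : Ediff (subquot_class _ z) = subquot_class _ (drcycle z).
Proof. exact: subquot_liftE. Qed.
End Differential.

Lemma Ediff_Ediff r p q p1 q1 p2 q2 (Hp1 : p1 = p - r%:Z)
    (Hq1 : q1 = q + r%:Z - 1) (Hp2 : p2 = p1 - r%:Z) (Hq2 : q2 = q1 + r%:Z - 1)
    (u : Epage r p q) :
  Ediff Hp2 Hq2 (Ediff Hp1 Hq1 u) = 0.
Proof.
have [z ->] := subquot_class_surj u; rewrite !EdiffE.
apply/subquot_class_eq0; rewrite /= dd ?rpred0 //; lia.
Qed.

(** The isomorphism of the homology of (E^r, d^r) with E^(r+1) is built
    backwards: (r+1)-cycles are r-cycles killed by d^r, and one computes the
    kernel and the image of the resulting map into the homology. The bidegrees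
    (pi, qi) and (po, qo) are those of the source of the incoming and of the
    target of the outgoing differential. *)
Section Turn.
Variables (r : nat) (p q pi qi po qo : int).
Hypotheses (Hpi : p = pi - r%:Z) (Hqi : q = qi + r%:Z - 1).
Hypotheses (Hpo : po = p - r%:Z) (Hqo : qo = q + r%:Z - 1).
Let din := Ediff Hpi Hqi.
Let dout := Ediff Hpo Hqo.

Lemma rcycle_weak (z : subgrp (rcycle r.+1 p (p + q))) :
  val z \in rcycle r p (p + q).
Proof.
have /andP[zF dz] := valP z; apply/andP; split=> //.
by apply: Fmono dz; lia.
Qed.

Definition weaken : {additive subgrp (rcycle r.+1 p (p + q)) ->
                      subgrp (rcycle r p (p + q))} :=
  corestr (g := val) rcycle_weak.

Lemma weaken_ker z : subquot_class (rboundary r p (p + q)) (weaken z)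
  \in ker_pred dout.
Proof.
apply/eqP; rewrite /dout EdiffE; apply/subquot_class_eq0.
apply/(rboundaryP _ _ _ erefl); exists (d (p + q) (po + qo) (val z)), 0.
rewrite rpred0 raddf0 addr0; split=> //.
have Hn : po + qo = p + q - 1 by lia.
have /(rcycleP _ _ _ Hn)[_] := valP z.
by apply: Fmono; lia.
Qed.

Definition turn_inv_rep : {additive subgrp (rcycle r.+1 p (p + q)) ->
                             homology din dout} :=
  subquot_class (im_pred din) \o
  corestr (g := subquot_class _ \o weaken) weaken_ker.

Lemma turn_inv_rep0 z :
  val z \in rboundary r.+1 p (p + q) -> turn_inv_rep z = 0.
Proof.
have Hm : pi + qi = p + q + 1 by lia.
case/(rboundaryP _ _ _ Hm)=> a [b [aF bF zE]].
have bZ : b \in rcycle r pi (pi + qi).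
  have Hn : p + q = pi + qi - 1 by lia.
  apply/(rcycleP _ _ _ Hn); split; first by apply: Fmono bF; lia.
  rewrite -Hpi (_ : d _ _ b = val z - a); last by rewrite zE addrAC subrr add0r.
  rewrite rpredB //; last by apply: Fmono aF; lia.
  by have /andP[] := valP z.
apply/subquot_class_eq0/asboolP; exists (subquot_class _ (Subgrp bZ)).
rewrite /din EdiffE; apply/subquot_class_eq/(rboundaryP _ _ _ Hm).
exists (- a), 0; rewrite rpredN rpred0 raddf0 addr0; split=> //=.
by rewrite zE opprD addrCA subrr addr0.
Qed.

(** If z = d w modulo r-boundaries, that is d w - z = a + d b, then
    z = - a + d (w - b), and w - b lies in F_(p+r). *)
Lemma turn_inv_rep_inj z :
  turn_inv_rep z = 0 -> val z \in rboundary r.+1 p (p + q).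
Proof.
have Hm : pi + qi = p + q + 1 by lia.
move/subquot_class_eq0/asboolP=> [u]; have [w ->] := subquot_class_surj u.
rewrite /din EdiffE => /subquot_class_eq/(rboundaryP _ _ _ Hm)[a [b [aF bF]]].
rewrite /= => dwz; apply/(rboundaryP _ _ _ Hm); exists (- a), (val w - b).
rewrite rpredN; split=> //.
  rewrite rpredB //; last by apply: Fmono bF; lia.
  by have /andP[wF _] := valP w; apply: Fmono wF; lia.
by rewrite raddfB addrCA -opprD -dwz opprB addrCA subrr addr0.
Qed.

(** If d^r kills the class of c, then d c = a + d b with a in F_(p-r-1) and b
    in F_(p-1); so c - b is an (r+1)-cycle with the same class in E^r. *)
Lemma turn_inv_rep_surj h : exists z, turn_inv_rep z = h.
Proof.
have Hn : po + qo = p + q - 1 by lia.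
have Hm : p + q = po + qo + 1 by lia.
have [[k kK] ->] := subquot_class_surj h.
have [c ck] := subquot_class_surj k.
have : dout (subquot_class _ c) = 0 by rewrite -ck; apply/eqP.
rewrite /dout EdiffE => /subquot_class_eq0/(rboundaryP _ _ _ Hm).
case=> a [b [aF bF /= dc]].
have /(rcycleP _ _ _ Hn)[cF _] := valP c.
have zZ : val c - b \in rcycle r.+1 p (p + q).
  apply/(rcycleP _ _ _ Hn); split.
    by rewrite rpredB //; apply: Fmono bF; lia.
  by rewrite raddfB dc addrK; apply: Fmono aF; lia.
exists (Subgrp zZ); congr subquot_class; apply/val_inj => /=; rewrite ck.
apply/subquot_class_eq/(rboundaryP _ _ _ erefl).
exists (- b), 0; rewrite rpredN rpred0 raddf0 addr0 /=; split=> //.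
  by apply: Fmono bF; lia.
by rewrite addrAC subrr add0r.
Qed.

Lemma turn_exists : isomorphic (homology din dout) (Epage r.+1 p q).
Proof.
apply: isomorphic_sym; exists (subquot_lift turn_inv_rep0).
exact: subquot_lift_bij turn_inv_rep_inj turn_inv_rep_surj.
Qed.
End Turn.

Definition filtered_ss : spectral_sequence :=
  @SpectralSequence Epage Ediff
    (fun r p q _ u => Ediff_Ediff _ _ _ _ u)
    (fun r p q => sval (cid (turn_exists _ _ _ _)))
    (fun r p q _ => svalP (cid (turn_exists _ _ _ _))).

(** The image of H_n(F_p) in H_n. *)
Definition Hfilt n p : {pred homology (d (n + 1) n) (d n (n - 1))} := fun h =>
  `[< exists z : cycles (d n (n - 1)),
        val (z : subgrp _) \in F p n /\ h = hclass _ z >].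
Arguments Hfilt : clear implicits.

Fact Hfilt_closed n p : zmod_closed (Hfilt n p).
Proof.
split=> [|x y].
  apply/asboolP; exists 0; rewrite raddf0 rpred0; split=> //.
  by rewrite /hclass raddf0.
move=> /asboolP[z [zF ->]] /asboolP[w [wF ->]].
apply/asboolP; exists (z - w); rewrite raddfB rpredB //; split=> //.
by rewrite /hclass raddfB.
Qed.
HB.instance Definition _ n p :=
  GRing.isZmodClosed.Build (homology (d (n + 1) n) (d n (n - 1)))
    (Hfilt n p) (Hfilt_closed n p).

Variables lo hi : int.
Hypothesis Flo : forall (p n : int) c, p <= lo -> c \in F p n -> c = 0.
Hypothesis Fhi : forall (p n : int) c, hi <= p -> c \in F p n.

(** Once r is large compared with the length of the filtration, Z^r_p consists
    of the cycles in F_p and its denominator is F_(p-1) plus all boundaries. *)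
Section Limit.
Variables (r : nat) (p q : int).
Hypotheses (rlo : p - r%:Z <= lo) (rhi : hi <= p + r%:Z - 1).
Let n := p + q.

Lemma rcycle_cycle (z : subgrp (rcycle r p n)) :
  val z \in ker_pred (d n (n - 1)).
Proof. by have /andP[_ /(Flo rlo) dz] := valP z; apply/eqP. Qed.

Definition rcycle_to_cycle :
    {additive subgrp (rcycle r p n) -> cycles (d n (n - 1))} :=
  corestr (g := val) rcycle_cycle.

Lemma rcycle_Hfilt z : hclass (d (n + 1) n) (rcycle_to_cycle z) \in Hfilt n p.
Proof.
have /andP[zF _] := valP z.
by apply/asboolP; exists (rcycle_to_cycle z).
Qed.

Definition to_graded :
    {additive subgrp (rcycle r p n) -> subquot (Hfilt n p) (Hfilt n (p - 1))} :=
  subquot_class _ \o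
  corestr (g := subquot_class _ \o rcycle_to_cycle) rcycle_Hfilt.

Lemma to_graded0 z : val z \in rboundary r p n -> to_graded z = 0.
Proof.
case/(rboundaryP _ _ _ erefl)=> a [b [aF bF zE]].
apply/subquot_class_eq0/asboolP.
have aK : a \in ker_pred (d n (n - 1)).
  have /eqP := rcycle_cycle z.
  by rewrite zE raddfD dd ?addrK // addr0 => /eqP.
exists (Subgrp aK); split=> //; apply/subquot_class_eq/asboolP.
by exists b; rewrite /= zE [a + _]addrC addrK.
Qed.

Lemma to_graded_inj z : to_graded z = 0 -> val z \in rboundary r p n.
Proof.
move/subquot_class_eq0/asboolP=> [w [wF /subquot_class_eq/asboolP[b]]] /= dE.
apply/(rboundaryP _ _ _ erefl); exists (val (w : subgrp _)), b; split=> //.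
  exact: Fhi.
by rewrite dE addrCA subrr addr0.
Qed.

Lemma to_graded_surj h : exists z, to_graded z = h.
Proof.
have [[k kG] ->] := subquot_class_surj h.
have [w [wF kE]] := asboolP _ kG.
have wZ : val (w : subgrp _) \in rcycle r p n.
  have /eqP dw := valP (w : subgrp _).
  by rewrite unfold_in /rcycle wF dw rpred0.
exists (Subgrp wZ); congr subquot_class; apply/val_inj.
by rewrite [RHS]kE; congr subquot_class; apply/val_inj.
Qed.

Lemma Epage_stable :
  isomorphic (Epage r p q) (subquot (Hfilt n p) (Hfilt n (p - 1))).
Proof.
exists (subquot_lift to_graded0).
exact: subquot_lift_bij to_graded_inj to_graded_surj.
Qed.
End Limit.

Lemma filtered_ss_converges :
  converges_to filtered_ss (fun n => homology (d (n + 1) n) (d n (n - 1))).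
Proof.
exists (fun n p => Hfilt n p : zmodClosed _); split.
- move=> n p x /asboolP[z [zF ->]]; apply/asboolP; exists z; split=> //.
  by apply: Fmono zF; lia.
- move=> n; exists lo => x /asboolP[z [zF ->]].
  by apply/subquot_class_eq0; rewrite (Flo _ zF) ?rpred0.
- move=> n; exists hi => x; have [z ->] := subquot_class_surj x.
  by apply/asboolP; exists z; split=> //; apply: Fhi.
move=> p q; exists (`|p - lo| + `|hi - p| + 1)%N; first by lia.
move=> r rE; have rlo : p - r%:Z <= lo by lia.
have rhi : hi <= p + r%:Z - 1 by lia.
split; last exact: Epage_stable.
- move=> u; have [z ->] := subquot_class_surj u.
  rewrite /diff_out /= EdiffE; apply/subquot_class_eq0 => /=.
  have Hn : p - r%:Z + (q + r%:Z - 1) = p + q - 1 by lia.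
  have /(rcycleP _ _ _ Hn)[_ dz] := valP z.
  by rewrite (Flo _ dz) ?rpred0.
move=> u; have [z ->] := subquot_class_surj u.
rewrite /diff_in /= EdiffE; apply/subquot_class_eq0.
have Hm : p + r%:Z + (q - r%:Z + 1) = p + q + 1 by lia.
apply/(rboundaryP _ _ _ Hm); exists 0, (val z); rewrite rpred0 add0r.
by split=> //; apply: Fhi.
Qed.
End FilteredComplex.
Arguments rcycle {C} d F r p n _.
Arguments rboundary {C} d F r p n _.

(** * Chains of a poset *)

Section Chains.
Variables (disp : Order.disp_t) (T : finPOrderType disp).
Implicit Types (Y A s t u : {set T}) (x y v w : T) (m n p : int) (aug : bool).

Definition is_gen aug Y n s := nchain Y n s && (aug || (0 <= n)).

(** Coefficients are indexed by all subsets, with value 0 at the sets that are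
    not generators. A chain of Y and the same chain in a larger poset then have
    the same coefficients, although they live in different types. *)
Definition coeff aug Y n (c : chains aug Y n) s : int :=
  if insub s is Some t then (c : {ffun gens aug Y n -> int}) t else 0.

Section Basics.
Variables (aug : bool) (Y : {set T}) (n : int).
Implicit Types c : chains aug Y n.

Lemma coeff_val c (t : gens aug Y n) :
  coeff c (val t) = (c : {ffun gens aug Y n -> int}) t.
Proof. by rewrite /coeff valK. Qed.

Lemma coeff_out c s : ~~ is_gen aug Y n s -> coeff c s = 0.
Proof. by move=> ns; rewrite /coeff insubN. Qed.

Lemma coeff_neq0 c s : coeff c s != 0 -> is_gen aug Y n s.
Proof. by apply: contra_neqT; apply: coeff_out. Qed.

Definition coeff_at s c := coeff c s.
Lemma coeff_at_is_zmod_morphism s : zmod_morphism (coeff_at s).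
Proof.
move=> c c'; rewrite /coeff_at /coeff.
by case: insub => [t|]; rewrite ?subr0 // !ffunE.
Qed.
HB.instance Definition _ s := GRing.isZmodMorphism.Build (chains aug Y n) int
  (coeff_at s) (coeff_at_is_zmod_morphism s).

Lemma coeffB c c' s : coeff (c - c') s = coeff c s - coeff c' s.
Proof. exact: coeff_at_is_zmod_morphism. Qed.
Lemma coeff0 s : coeff (0 : chains aug Y n) s = 0.
Proof. exact: (raddf0 (coeff_at s)). Qed.
Lemma coeffN c s : coeff (- c) s = - coeff c s.
Proof. exact: (raddfN (coeff_at s)). Qed.
Lemma coeffMz c k s : coeff (c *~ k) s = coeff c s * k.
Proof. by rewrite -mulrzz; apply: (raddfMz (coeff_at s)). Qed.
Lemma coeff_sum I (r : seq I) (P : pred I) (f : I -> chains aug Y n) s :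
  coeff (\sum_(i <- r | P i) f i) s = \sum_(i <- r | P i) coeff (f i) s.
Proof. exact: (raddf_sum (coeff_at s)). Qed.

Lemma chains_ext c c' : (forall s, coeff c s = coeff c' s) -> c = c'.
Proof. by move=> E; apply/ffunP => t; rewrite -!coeff_val. Qed.

Lemma coeff_gen u s :
  coeff (gen aug Y n u) s = (is_gen aug Y n s && (s == u))%:R.
Proof.
case: (boolP (is_gen aug Y n s)) => [gs|]; last exact: coeff_out.
by rewrite -[s]/(val (Sub s gs : gens aug Y n)) coeff_val ffunE.
Qed.

Lemma sum_gens c u (g : {set T} -> int) :
  \sum_(t : gens aug Y n) (val t == u)%:R * ((c : {ffun _}) t * g (val t))
    = coeff c u * g u.
Proof.
case: (boolP (is_gen aug Y n u)) => [gu|ngu].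
  rewrite (bigD1 (Sub u gu : gens aug Y n)) //= eqxx mul1r -coeff_val /=.
  rewrite big1 ?addr0 // => t; rewrite -val_eqE /= => /negbTE->.
  by rewrite mul0r.
rewrite coeff_out // mul0r big1 // => t _.
case: eqP => [tu|]; last by rewrite mul0r.
by case/negP: ngu; rewrite -tu; apply: valP t.
Qed.
End Basics.

Lemma is_gen_sub aug Y n s : is_gen aug Y n s -> s \subset Y.
Proof. by case/andP=> /and3P[]. Qed.

Lemma is_gen_comp aug Y n s x y :
  is_gen aug Y n s -> x \in s -> y \in s -> (x >=< y)%O.
Proof.
case/andP=> /and3P[_ /forall_inP ch _] _ xs ys.
by move/forall_inP: (ch x xs); apply.
Qed.

Lemma is_gen_card aug Y n s : is_gen aug Y n s -> #|s|%:Z = n + 1.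
Proof. by case/andP=> /and3P[_ _ /eqP]. Qed.

Lemma is_gen_mono aug Y n s aug' Y' : is_gen aug Y n s -> s \subset Y' ->
  aug' || (s != set0) -> is_gen aug' Y' n s.
Proof.
case/andP=> /and3P[_ ch cs] _ sY' a; apply/andP; split; first exact/and3P.
case/orP: a => [->//|s0]; apply/orP; right.
by move: s0 (eqP cs); rewrite -cards_eq0; lia.
Qed.

Lemma is_genD1 aug Y n m s v : m = n - 1 -> is_gen aug Y n s -> v \in s ->
  aug || (s :\ v != set0) -> is_gen aug Y m (s :\ v).
Proof.
move=> -> /andP[ns _] vs a; have ms := nchainD1 ns vs.
apply: (@is_gen_mono true Y _ _ _ _ _ _ a); last by case/and3P: ms.
by rewrite /is_gen ms.
Qed.

(** The faces equal to s come from the sets obtained by adding a point to s,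
    and a set with a nonzero coefficient is automatically a chain. The case
    distinction concerns the empty chain, a generator only of the augmented
    complex. *)
Lemma coeff_bd aug Y m n (c : chains aug Y m) s : n = m - 1 ->
  coeff (bd aug Y m n c) s = if aug || (s != set0) then
    \sum_(v | v \notin s) coeff c (v |: s) * sgn (v |: s) v else 0.
Proof.
move=> nm.
have -> : coeff (bd aug Y m n c) s = (is_gen aug Y n s)%:R *
    \sum_(v | v \notin s) coeff c (v |: s) * sgn (v |: s) v.
  rewrite -[bd aug Y m n c]/(bd_fun n c) coeff_sum mulr_sumr [RHS]big_mkcond.
  under [LHS]eq_bigr do rewrite coeff_sum big_mkcond.
  rewrite exchange_big; apply: eq_bigr => v _ /=.
  rewrite -(sum_gens c (v |: s) (fun t => sgn t v)).
  case: ifP => vs; last first.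
    apply: big1 => t _; rewrite -[sval t]/(val t); case: ifP => // vt.
    rewrite coeffMz coeff_gen; case: eqP => [E|]; last by rewrite andbF mul0r.
    by move: vs; rewrite E !inE eqxx.
  rewrite mulr_sumr; apply: eq_bigr => t _; rewrite -[sval t]/(val t).
  case: (eqVneq (val t) (v |: s)) => [E|tvs].
    by rewrite E setU11 coeffMz coeff_gen setU1K // eqxx andbT mul1r.
  rewrite mul0r mulr0; case: ifP => // vt.
  rewrite coeffMz coeff_gen; case: eqP => [E|]; last by rewrite andbF mul0r.
  by case/eqP: tvs; rewrite E setD1K.
case: (boolP (is_gen aug Y n s)) => [gs|ngs]; last first.
  rewrite mul0r; case: ifP => // a; rewrite big1 // => v vs.
  suff -> : coeff c (v |: s) = 0 by rewrite mul0r.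
  apply/eqP; apply: contraNT ngs => /coeff_neq0 g.
  by have := is_genD1 nm g (setU11 _ _); rewrite setU1K //; apply.
rewrite mul1r ifT //; case: aug gs {c} => //= /[dup] /is_gen_card + /andP[_].
by rewrite -cards_eq0; lia.
Qed.

Lemma sgnU1 s v w : v \notin s ->
  sgn (v |: s) w = (-1) ^+ (v < w)%O * sgn s w.
Proof.
move=> vs; rewrite /sgn -exprD; congr (_ ^+ _).
rewrite (cardsD1 v) !inE eqxx /=; congr (_ + _)%N.
apply: eq_card => z; rewrite !inE.
by case: eqVneq => //= ->; rewrite (negbTE vs).
Qed.

Lemma sgn_opp v w : (v >=< w)%O -> v != w ->
  (-1 : int) ^+ (w < v)%O = - (-1) ^+ (v < w)%O.
Proof. by move=> vw; case: (comparable_ltgtP vw) => // -> /eqP. Qed.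

(** Removing v and then w from a chain, or w and then v, gives opposite signs:
    exactly one of the two points lies below the other. *)
Lemma sgn_swap s v w : (v >=< w)%O -> v != w -> v \notin s -> w \notin s ->
  sgn (v |: (w |: s)) v * sgn (w |: s) w
    = - (sgn (v |: (w |: s)) w * sgn (v |: s) v).
Proof.
move=> vw nvw vs ws; have vws : v \notin w |: s by rewrite !inE negb_or nvw.
rewrite !(sgnU1 _ vws) !(sgnU1 _ ws) !(sgnU1 _ vs) !ltxx !mul1r sgn_opp //; lia.
Qed.

Lemma sgn2 s v : sgn s v * sgn s v = 1.
Proof. by rewrite -expr2 sqrr_sign. Qed.

(** The same relation with the signs of v and w in the large chain brought
    together. *)
Lemma sgn_swap2 s v w : (v >=< w)%O -> v != w -> v \notin s -> w \notin s ->
  sgn (v |: (w |: s)) w * sgn (v |: (w |: s)) v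
    = - (sgn (v |: s) v * sgn (w |: s) w).
Proof.
move=> vw nvw vs ws; rewrite -[LHS]mulr1 -(sgn2 (w |: s) w) mulrA.
rewrite -[X in X * _]mulrA.
rewrite sgn_swap // mulrN mulrA sgn2 mul1r mulNr; lia.
Qed.

Lemma bd_bd aug Y m n k : n = m - 1 -> k = n - 1 ->
  forall c : chains aug Y m, bd aug Y n k (bd aug Y m n c) = 0.
Proof.
move=> nm kn c; apply: chains_ext => s.
rewrite coeff0 coeff_bd //; case: ifP => // a.
pose f v w := if (v \notin s) && (w \notin v |: s) then
  coeff c (w |: (v |: s)) * sgn (w |: (v |: s)) w * sgn (v |: s) v else 0.
have fN v w : f v w = - f w v.
  have cE i j : (i \notin s) && (j \notin i |: s)
      = [&& i \notin s, j \notin s & i != j].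
    by rewrite !inE negb_or eq_sym; case: (i \in s); case: (j \in s); case: eqP.
  rewrite /f !cE [w == v]eq_sym andbCA.
  case: ifP => [/and3P[ws vs vw]|_]; last by rewrite oppr0.
  rewrite setUCA -!mulrA -mulrN.
  have [->|/coeff_neq0 g] := eqVneq (coeff c (v |: (w |: s))) 0.
    by rewrite !mul0r.
  congr (_ * _); rewrite sgn_swap ?opprK //.
  by apply: is_gen_comp g _ _; rewrite !inE eqxx ?orbT.
have -> : \sum_(v | v \notin s) coeff (bd aug Y m n c) (v |: s) * sgn (v |: s) v
    = \sum_v \sum_w f v w.
  rewrite big_mkcond; apply: eq_bigr => v _; rewrite /f.
  case: (boolP (v \in s)) => vs /=; first by rewrite big1.
  rewrite coeff_bd // ifT; last first.
    by apply/orP; right; apply/set0Pn; exists v; rewrite setU11.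
  by rewrite mulr_suml [LHS]big_mkcond.
set S := LHS; suff : S = - S by lia.
rewrite {1}/S exchange_big -sumrN; apply: eq_bigr => v _.
by rewrite -sumrN; apply: eq_bigr => w _; rewrite fN.
Qed.

Lemma coeff_push aug Y n aug' Y' n' (c : chains aug Y n) s :
  coeff (push aug' Y' n' c) s = (is_gen aug' Y' n' s)%:R * coeff c s.
Proof.
rewrite coeff_sum -[coeff c s]mulr1 -(sum_gens c s (fun=> 1)) mulr_sumr.
apply: eq_bigr => t _; rewrite coeffMz coeff_gen eq_sym mulr1.
by case: is_gen; rewrite ?mul0r //= mul1r.
Qed.

Lemma push_is_zmod_morphism aug Y n aug' Y' n' :
  zmod_morphism (@push _ T aug Y n aug' Y' n').
Proof.
by move=> c c'; apply: chains_ext => s; rewrite !(coeffB, coeff_push) mulrBr.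
Qed.
HB.instance Definition _ aug Y n aug' Y' n' :=
  GRing.isZmodMorphism.Build (chains aug Y n) (chains aug' Y' n')
    (@push _ T aug Y n aug' Y' n') (@push_is_zmod_morphism aug Y n aug' Y' n').

Definition supp_in aug Y n A : {pred chains aug Y n} :=
  fun c => [forall s, (coeff c s != 0) ==> (s \subset A)].
Arguments supp_in : clear implicits.

Lemma supp_inP aug Y n A c :
  reflect (forall s, coeff c s != 0 -> s \subset A) (c \in supp_in aug Y n A).
Proof.
by apply: (iffP forallP) => h s; [move/implyP: (h s)|apply/implyP/h].
Qed.

Fact supp_in_closed aug Y n A : zmod_closed (supp_in aug Y n A).
Proof.
split=> [|c c' /supp_inP cA /supp_inP cA']; apply/supp_inP=> s.
  by rewrite coeff0 eqxx.
rewrite coeffB; apply: contraR => sA.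
by rewrite (contraNeq (cA s) sA) (contraNeq (cA' s) sA) subrr.
Qed.
HB.instance Definition _ aug Y n A :=
  GRing.isZmodClosed.Build (chains aug Y n) (supp_in aug Y n A)
    (supp_in_closed aug Y n A).

Arguments supp_inP {aug Y n A} c.

Lemma supp_in_mono aug Y n A A' c : A \subset A' ->
  c \in supp_in aug Y n A -> c \in supp_in aug Y n A'.
Proof.
by move=> AA /supp_inP h; apply/supp_inP=> s /h /subset_trans; apply.
Qed.

Lemma supp_in0 aug Y n A c s : c \in supp_in aug Y n A ->
  ~~ (s \subset A) -> coeff c s = 0.
Proof. by move=> /supp_inP cA; apply: contraNeq; apply: cA. Qed.

Lemma is_gen_set0 Y n : is_gen false Y n set0 = false.
Proof.
by apply/negP=> /[dup] /is_gen_card + /andP[_ /=]; rewrite cards0; lia.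
Qed.

(** The implication on augmentations excludes the one bad case: when the target
    is augmented and the source is not, the boundary of a point differs. *)
Lemma bd_push aug Y m n aug' Y' (c : chains aug Y m) : n = m - 1 ->
    aug' ==> aug -> c \in supp_in aug Y m Y' ->
  bd aug' Y' m n (push aug' Y' m c) = push aug' Y' n (bd aug Y m n c).
Proof.
move=> nm a cY; apply: chains_ext => s; rewrite coeff_push !coeff_bd //.
case: (boolP (aug' || (s != set0))) => [s0|]; last first.
  rewrite negb_or => /andP[/negbTE -> /negbNE/eqP ->].
  by rewrite is_gen_set0 mul0r.
have -> : aug || (s != set0).
  by case/orP: s0 => [a'|->]; rewrite ?orbT //; move: a; rewrite a' /= => ->.
rewrite mulr_sumr; apply: eq_bigr => v vs; rewrite coeff_push.
have [->|cv] := eqVneq (coeff c (v |: s)) 0; first by rewrite !(mulr0, mul0r).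
have gv := coeff_neq0 cv; have /supp_inP/(_ _ cv) vY := cY.
rewrite (is_gen_mono gv vY) ?mul1r; last first.
  by apply/orP; right; apply/set0Pn; exists v; rewrite setU11.
have sY : s \subset Y' by apply: subset_trans vY; apply: subsetUr.
have := is_genD1 nm gv (setU11 _ _); rewrite setU1K // => g.
rewrite (is_gen_mono (g _) sY s0) ?mul1r //.
case/orP: s0 => [a'|->]; rewrite ?orbT //.
by move: a; rewrite a' /= => ->.
Qed.

Lemma is_gen_in aug Y Y' n s : is_gen aug Y n s -> s \subset Y' ->
  is_gen aug Y' n s.
Proof.
by case/andP=> /and3P[_ ch cs] a sY; rewrite /is_gen a andbT; apply/and3P.
Qed.

Lemma supp_in_setT aug Y n c : c \in supp_in aug Y n setT.
Proof. by apply/supp_inP=> s _; apply: subsetT. Qed.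

Lemma push_gen aug Y n aug' Y' n' u : is_gen aug Y n u ->
  push aug' Y' n' (gen aug Y n u) = gen aug' Y' n' u.
Proof.
move=> g; apply: chains_ext => s; rewrite coeff_push !coeff_gen.
by case: eqVneq => [->|]; rewrite ?g ?andbT ?andbF /= ?mulr1 ?mulr0.
Qed.

Lemma push_push aug Y n aug' Y' n' aug'' Y'' n'' (c : chains aug Y n) :
  (forall s, is_gen aug'' Y'' n'' s -> coeff c s != 0 -> is_gen aug' Y' n' s) ->
  push aug'' Y'' n'' (push aug' Y' n' c) = push aug'' Y'' n'' c.
Proof.
move=> h; apply: chains_ext => s; rewrite !coeff_push.
case: (boolP (is_gen aug'' Y'' n'' s)) => [g|]; last by rewrite !mul0r.
have [->|c0] := eqVneq (coeff c s) 0; first by rewrite !mulr0.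
by rewrite h // !mul1r.
Qed.

Lemma push_id aug Y n (c : chains aug Y n) : push aug Y n c = c.
Proof.
apply: chains_ext => s; rewrite coeff_push.
by case: (boolP (is_gen aug Y n s)) => [_|/coeff_out ->]; rewrite ?mul1r ?mulr0.
Qed.

Lemma push_cycle aug Y n aug' Y' n' (z : cyc aug Y n) :
    n' = n -> aug' ==> aug -> Y \subset Y' ->
  push aug' Y' n' (cyc_val z) \in ker_pred (bd aug' Y' n' (n' - 1)).
Proof.
move=> -> a YY'; apply/eqP; rewrite bd_push //; last first.
  apply/supp_inP=> s /coeff_neq0/is_gen_sub sY; exact: subset_trans sY YY'.
by rewrite (eqP (valP (z : subgrp _))) raddf0.
Qed.

Lemma supp_in_set0 Y n c : c \in supp_in false Y n set0 -> c = 0.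
Proof.
move=> /supp_inP c0; apply: chains_ext => s; rewrite coeff0.
apply/eqP; apply: contraT => cs; have := coeff_neq0 cs.
by have := c0 s cs; rewrite subset0 => /eqP->; rewrite is_gen_set0.
Qed.

Lemma chains_neg Y n (c : chains false Y n) : n <= -1 -> c = 0.
Proof.
move=> n0; apply: chains_ext => s; rewrite coeff0 coeff_out //.
by apply/negP=> /andP[_ /=]; lia.
Qed.
(** * Links and cones *)

Section Star.
Variables (A : {set T}) (x : T).

(** In terms of generators: [link] sends s to sgn_s(x) (s - x) if x is in s and
    to 0 otherwise, and [cone] sends t to sgn_s(x) s, where s is t with x
    added. The empty chain, a generator of the target of [link], corresponds to
    the chain with the single point x. *)
Definition link Y n m (c : chains false Y n) : chains true (Chat A x) m :=
  [ffun t : gens true (Chat A x) m =>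
    coeff c (x |: val t) * sgn (x |: val t) x].

Definition cone Y m n (c : chains true (Chat A x) m) : chains false Y n :=
  [ffun s : gens false Y n =>
    if x \in val s then coeff c (val s :\ x) * sgn (val s) x else 0].

Lemma link_is_zmod_morphism Y n m : zmod_morphism (@link Y n m).
Proof. by move=> c c'; apply/ffunP=> t; rewrite !ffunE coeffB mulrBl. Qed.
HB.instance Definition _ Y n m :=
  GRing.isZmodMorphism.Build (chains false Y n) (chains true (Chat A x) m)
    (@link Y n m) (@link_is_zmod_morphism Y n m).

Lemma cone_is_zmod_morphism Y m n : zmod_morphism (@cone Y m n).
Proof.
move=> c c'; apply/ffunP=> t; rewrite !ffunE coeffB.
by case: ifP; rewrite ?subr0 // mulrBl.
Qed.
HB.instance Definition _ Y m n :=
  GRing.isZmodMorphism.Build (chains true (Chat A x) m) (chains false Y n)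
    (@cone Y m n) (@cone_is_zmod_morphism Y m n).

Lemma notin_Chat s : s \subset Chat A x -> x \notin s.
Proof. by move=> sC; apply/negP=> /(subsetP sC); rewrite !inE eqxx. Qed.

(** The support condition makes the formula hold at every t, generator or not:
    if x added to t is a chain of A, then t lies in the punctured star. *)
Lemma coeff_link Y n m (c : chains false Y n) t : m = n - 1 ->
    c \in supp_in false Y n A ->
  coeff (link m c) t = if x \in t then 0 else coeff c (x |: t) * sgn (x |: t) x.
Proof.
move=> mn cA; case: (boolP (is_gen true (Chat A x) m t)) => [g|ng].
  have -> : coeff (link m c) t
      = coeff (link m c) (val (Sub t g : gens _ _ _)) by [].
  rewrite coeff_val ffunE /= ifN //; apply: notin_Chat.
  exact: is_gen_sub g.
rewrite coeff_out //; case: ifPn => // xt.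
suff -> : coeff c (x |: t) = 0 by rewrite mul0r.
apply/eqP; apply: contraNT ng => ct.
have g := coeff_neq0 ct; have /supp_inP/(_ _ ct) sA := cA.
have ms : is_gen true Y m t.
  rewrite -[t](setU1K xt).
  apply: (is_genD1 (aug := true) mn _ (setU11 _ _) isT).
  exact: (is_gen_mono (aug' := true) g (is_gen_sub g) isT).
apply: is_gen_mono ms _ _ => //; apply/subsetP=> y yt.
have yx : (y >=< x)%O by apply: is_gen_comp g _ _; rewrite !inE ?yt ?eqxx ?orbT.
have yA : y \in A by apply: (subsetP sA); rewrite !inE yt orbT.
rewrite !inE yA /= -/(y >=< x)%O; apply/andP; split=> //.
by apply: contraNneq xt => <-.
Qed.

Lemma coeff_cone Y m n (c : chains true (Chat A x) m) s : n = m + 1 ->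
    x \in Y -> Chat A x \subset Y ->
  coeff (cone Y n c) s = if x \in s then coeff c (s :\ x) * sgn s x else 0.
Proof.
move=> nm xY CY; case: (boolP (is_gen false Y n s)) => [g|ng].
  have -> : coeff (cone Y n c) s
      = coeff (cone Y n c) (val (Sub s g : gens _ _ _)) by [].
  by rewrite coeff_val ffunE.
rewrite coeff_out //; case: ifP => // xs.
suff -> : coeff c (s :\ x) = 0 by rewrite mul0r.
apply/eqP; apply: contraNT ng => ct.
have g := coeff_neq0 ct; have sC := is_gen_sub g.
have sY : s \subset Y.
  by rewrite -(setD1K xs) subUset sub1set xY (subset_trans sC CY).
have cs : #|s|%:Z = n + 1.
  by rewrite nm -(is_gen_card g) (cardsD1 x s) xs addrC.
apply/andP; split; last by move: cs; rewrite (cardsD1 x s) xs; lia.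
apply/and3P; split=> //; last exact/eqP.
have cx y : y \in s -> (x >=< y)%O.
  have [->|yx ys] := eqVneq y x; first by rewrite comparablexx.
  have := subsetP sC y; rewrite !inE ys yx => /(_ isT) /orP[] /andP[_ h];
    by rewrite /Order.comparable h ?orbT.
apply/forall_inP=> y ys; apply/forall_inP=> z zs.
have [->|yx] := eqVneq y x; first exact: cx.
have [->|zx] := eqVneq z x; first by rewrite comparable_sym; exact: cx.
by apply: is_gen_comp g _ _; rewrite !inE ?yx ?zx.
Qed.
End Star.
Lemma link_gen A x Y n m u : is_gen false Y n u ->
  link A x m (gen false Y n u)
    = if x \in u then gen true (Chat A x) m (u :\ x) *~ sgn u x else 0.
Proof.
move=> g; apply/ffunP=> t; rewrite ffunE coeff_gen.
have xt : x \notin val t by apply: notin_Chat; apply: is_gen_sub (valP t).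
have -> : (is_gen false Y n (x |: val t) && (x |: val t == u))
    = (x \in u) && (val t == u :\ x).
  apply/andP/andP=> [[_ /eqP <-]|[xu /eqP ->]].
    by rewrite setU11 setU1K.
  by rewrite setD1K.
case: ifP => xu /=; last by rewrite mul0r ffunE.
rewrite -[RHS](coeff_val (gen true (Chat A x) m (u :\ x) *~ sgn u x) t).
rewrite coeffMz coeff_val ffunE.
by case: eqP => [->|]; rewrite ?mul0r // setD1K.
Qed.

Lemma bd_supp aug Y m n A (c : chains aug Y m) : n = m - 1 ->
  c \in supp_in aug Y m A -> bd aug Y m n c \in supp_in aug Y n A.
Proof.
move=> nm cA; apply/supp_inP=> s; apply: contraR => sA.
rewrite coeff_bd //; case: ifP => // _; rewrite big1 // => v _.
rewrite (supp_in0 cA) ?mul0r //; apply: contra sA.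
exact: subset_trans (subsetUr _ _).
Qed.

Lemma push_supp aug Y n aug' Y' (c : chains aug Y n) A : Y \subset A ->
  push aug' Y' n c \in supp_in aug' Y' n A.
Proof.
move=> YA; apply/supp_inP=> s; rewrite coeff_push.
apply: contraR => sA; rewrite (_ : coeff c s = 0) ?mulr0 //; apply/eqP.
by apply: contraR sA => /coeff_neq0/is_gen_sub/subset_trans; apply.
Qed.

(** Deleting first x and then v, or first v and then x, gives opposite signs. *)
Lemma bd_link A x Y n m k (c : chains false Y n) : m = n - 1 -> k = m - 1 ->
  c \in supp_in false Y n A ->
  bd true (Chat A x) m k (link A x m c) = - link A x k (bd false Y n m c).
Proof.
move=> mn km cA; apply: chains_ext => t.
rewrite coeffN coeff_bd //= coeff_link ?bd_supp //.
have [xt|xt] := boolP (x \in t).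
  by rewrite oppr0 big1 // => v _; rewrite coeff_link // !inE xt orbT mul0r.
rewrite coeff_bd // ifT; last by apply/set0Pn; exists x; rewrite setU11.
rewrite mulr_suml -sumrN [LHS]big_mkcond [RHS]big_mkcond; apply: eq_bigr => v _.
rewrite coeff_link // !inE negb_or (negbTE xt) orbF [x == v]eq_sym.
case: eqVneq => [_|vx] /=; first by rewrite mul0r; case: ifP.
case: ifP => // vt; rewrite setUCA.
have [->|/coeff_neq0 g] := eqVneq (coeff c (v |: (x |: t))) 0.
  by rewrite !mul0r oppr0.
rewrite -!mulrA -mulrN sgn_swap ?opprK //.
by apply: is_gen_comp g _ _; rewrite !inE eqxx ?orbT.
Qed.

(** Deleting x from x added to t gives t back with coefficient 1, since the
    sign in [cone] is the sign of that face; the other faces contain x and form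
    the cone over the boundary, up to a sign. *)
Lemma bd_cone A x Y m n k (c : chains true (Chat A x) m) :
    n = m + 1 -> k = m - 1 -> x \in Y -> Chat A x \subset Y ->
  bd false Y n m (cone Y n c)
    = push false Y m c - cone Y m (bd true (Chat A x) m k c).
Proof.
move=> nm km xY CY; apply: chains_ext => s.
have mn : m = n - 1 by rewrite nm addrK.
rewrite coeffB coeff_bd // coeff_push coeff_cone //; last by rewrite km subrK.
have cx t : x \in t -> coeff c t = 0.
  move=> xt; apply/eqP; apply: contraTT xt => /coeff_neq0/is_gen_sub.
  exact: notin_Chat.
have [xs|xs] := boolP (x \in s).
  rewrite (cx s) // mulr0 sub0r ifT; last by apply/set0Pn; exists x.
  rewrite [in RHS]coeff_bd //= [in RHS](bigD1 x) ?inE ?eqxx //= cx ?setU11 //.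
  rewrite mul0r add0r.
  rewrite mulr_suml -sumrN; apply: eq_big => [v|v vs].
    by rewrite !inE; case: eqVneq => [->|] //=; rewrite ?xs ?andbT ?andbF.
  have vx : v != x by apply: contraNneq vs => ->.
  rewrite coeff_cone // !inE xs orbT.
  have -> : (v |: s) :\ x = v |: (s :\ x).
    by apply/setP=> z; rewrite !inE; case: (eqVneq z v) => [->|]; rewrite ?vx.
  set t := s :\ x; have xt : x \notin t by rewrite !inE eqxx.
  have vt : v \notin t by rewrite !inE negb_and vs orbT.
  have [->|/coeff_neq0 g] := eqVneq (coeff c (v |: t)) 0.
    by rewrite !mul0r oppr0.
  rewrite -!mulrA -mulrN; congr (_ * _).
  rewrite -[s](setD1K xs) -/t sgn_swap2 //.
  have /subsetP/(_ v) := is_gen_sub g; rewrite setU11 !inE => /(_ isT).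
  by case/andP=> _ /orP[] /andP[_ h]; rewrite /Order.comparable h ?orbT.
rewrite subr0; case: ifPn => [s0|/negbNE/eqP->]; last first.
  by rewrite is_gen_set0 mul0r.
rewrite (bigD1 x) //= big1 ?addr0 => [|v /andP[vs vx]]; last first.
  rewrite coeff_cone // !inE eq_sym (negbTE vx) (negbTE xs) /=.
  by rewrite mul0r.
rewrite coeff_cone // setU11 setU1K // -mulrA sgn2 mulr1.
have [->|/coeff_neq0 g] := eqVneq (coeff c s) 0; first by rewrite mulr0.
rewrite (is_gen_mono g) ?mul1r //.
exact: subset_trans (is_gen_sub g) CY.
Qed.

(** * Attaching an antichain *)

Section Stratum.
Variables (A A' : {set T}).
Hypothesis A'A : A' \subset A.
Hypothesis anti : is_antichain (A :\: A').
Hypothesis CA : forall x, x \in A :\: A' -> Chat A x \subset A'.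
Let D := A :\: A'.
Local Notation C := (chains false [set: T]).
Local Notation supp n := (supp_in false [set: T] n).
Implicit Types (i j : {x | x \in D}).

Lemma stratum_notin x : x \in D -> x \notin A'.
Proof. by case/setDP. Qed.

Lemma stratum_comp x y : x \in D -> y \in D -> (x >=< y)%O -> x = y.
Proof.
move=> xD yD /orP[] h.
  by have /forall_inP/(_ y yD)/implyP/(_ h)/eqP := forall_inP anti x xD.
by have /forall_inP/(_ x xD)/implyP/(_ h)/eqP := forall_inP anti y yD.
Qed.

Lemma link_supp n m (c : C n) x : m = n - 1 -> x \in D -> c \in supp n A' ->
  link A x m c = 0.
Proof.
move=> mn xD cA; apply: chains_ext => t.
rewrite coeff0 coeff_link ?(supp_in_mono A'A) //; case: ifP => // xt.
rewrite (supp_in0 cA) ?mul0r //.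
by apply/negP=> /subsetP/(_ x (setU11 _ _)); apply/negP/stratum_notin.
Qed.

Definition tcone m n (sigma : forall i, chains true (Chat A (val i)) m) : C n :=
  \sum_i cone [set: T] n (sigma i).

Section TotalCone.
Variables (m n : int) (sigma : forall i, chains true (Chat A (val i)) m).
Hypothesis nm : n = m + 1.

Lemma coeff_tcone s : coeff (tcone n sigma) s = \sum_i
  (if val i \in s then coeff (sigma i) (s :\ val i) * sgn s (val i) else 0).
Proof.
by rewrite coeff_sum; apply: eq_bigr => i _; rewrite coeff_cone ?inE ?subsetT.
Qed.

Lemma tcone_supp : tcone n sigma \in supp n A.
Proof.
apply/supp_inP=> s; apply: contraR => sA; rewrite coeff_tcone big1 // => i _.
case: ifP => // si; suff -> : coeff (sigma i) (s :\ val i) = 0 by rewrite mul0r.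
apply/eqP; apply: contraR sA => /coeff_neq0/is_gen_sub sC.
have /setDP[iA _] := valP i.
rewrite -(setD1K si) subUset sub1set iA (subset_trans sC) //.
exact: subset_trans (CA (valP i)) A'A.
Qed.

(** The cone with apex j contributes nothing to the link of i <> j, because its
    chains contain j and two distinct points of the antichain do not lie on a
    common chain. *)
Lemma link_tcone i : link A (val i) m (tcone n sigma) = sigma i.
Proof.
have mn : m = n - 1 by rewrite nm addrK.
apply: chains_ext => t; rewrite coeff_link ?tcone_supp //.
have cA j u : coeff (sigma j) u != 0 -> u \subset A'.
  by move=> /coeff_neq0/is_gen_sub/subset_trans; apply; apply: CA (valP j).
case: ifPn => it.
  apply/esym/eqP; apply: contraTT it => /coeff_neq0/is_gen_sub.
  exact: notin_Chat.
rewrite coeff_tcone (bigD1 i) //= big1 ?addr0 => [|j ji].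
  by rewrite setU11 setU1K // -mulrA sgn2 mulr1.
case: ifP => // jt; apply/eqP; rewrite mulf_eq0; apply/orP; left.
apply: contraNT (stratum_notin (valP i)) => /cA/subsetP; apply.
by rewrite !inE eqxx andbT; apply: contraNneq ji => E; apply/eqP/val_inj.
Qed.

Lemma bd_tcone k : k = m - 1 -> bd false [set: T] n m (tcone n sigma)
  = \sum_i push false [set: T] m (sigma i)
    - tcone m (fun i => bd true _ m k (sigma i)).
Proof.
move=> km; rewrite raddf_sum -sumrB; apply: eq_bigr => i _.
by apply: bd_cone; rewrite ?inE ?subsetT.
Qed.

Lemma sum_push_supp :
  \sum_i push false [set: T] m (sigma i) \in supp m A'.
Proof. by apply: rpred_sum => i _; apply/push_supp/CA/(valP i). Qed.
End TotalCone.

Lemma bd_tcone_cycles m n n'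
    (sigma : forall i, cyc true (Chat A (val i)) m) :
    n = m + 1 -> n' = m ->
  bd false [set: T] n n' (tcone n (fun i => cyc_val (sigma i)))
    = \sum_i push false [set: T] n' (cyc_val (sigma i)).
Proof.
move=> nm ->; rewrite (bd_tcone _ nm erefl) /tcone.
have z i : bd true _ m (m - 1) (cyc_val (sigma i)) = 0.
  by apply/eqP/(valP (sigma i : subgrp _)).
by rewrite [X in _ - X]big1 ?subr0 // => i _; rewrite z raddf0.
Qed.

(** A chain of A that is not contained in A' has exactly one point in the
    antichain A :\: A', so it is counted by exactly one of the cones, with the
    sign squared. *)
Lemma sub_tcone_supp m n (c : C n) : n = m + 1 -> c \in supp n A ->
  c - tcone n (fun i => link A (val i) m c) \in supp n A'.
Proof.
move=> nm cA; have mn : m = n - 1 by rewrite nm addrK.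
apply/supp_inP=> s; apply: contraR => sA'; rewrite coeffB coeff_tcone //.
have [c0|cs] := eqVneq (coeff c s) 0.
  rewrite c0 big1 ?subr0 // => i _; case: ifP => // si.
  by rewrite coeff_link // !inE eqxx /= setD1K // c0 !mul0r.
have [y ys yA'] := subsetPn sA'.
have sA := elimT (supp_inP c) cA s cs.
have yD : y \in D by rewrite inE yA' (subsetP sA).
rewrite (bigD1 (Sub y yD)) //= ys big1 => [|j jy].
  by rewrite coeff_link // !inE eqxx /= setD1K // -mulrA sgn2 mulr1 addr0 subrr.
case: ifP => // js; case/eqP: jy; apply: val_inj.
apply: stratum_comp yD _; first exact: valP.
by apply: is_gen_comp (coeff_neq0 cs) _ _.
Qed.
End Stratum.
End Chains.
Arguments supp_in {disp T} aug Y n A _.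
Arguments supp_inP {disp T aug Y n A} c.

(** * The first page *)

Section AntichainFiltration.
Variables (disp : Order.disp_t) (T : finPOrderType disp).
Variable X : int -> {set T}.
Hypotheses (HX : is_filtration X) (HA : induced_by_antichains X).
Implicit Types (p q n m : int).
Local Notation C := (chains false [set: T]).
Local Notation d := (bd false [set: T]).

Lemma filtration_mono p p' : p <= p' -> X p \subset X p'.
Proof.
move=> pp; have -> : p' = p + `|p' - p|%N%:Z by lia.
elim: `|_|%N => [|k IH]; first by rewrite addr0.
apply: subset_trans IH _; rewrite (_ : p + k.+1%:Z = p + k%:Z + 1); last lia.
exact: HX.1.
Qed.

Lemma filtration_neg p : p <= -1 -> X p = set0.
Proof. by move/filtration_mono; rewrite HA.1 subset0 => /eqP. Qed.

Lemma filtration_top : exists hi, forall p, hi <= p -> X p = setT.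
Proof.
pose f x := sval (cid (HX.2 x)); exists (\sum_x `|f x|%N)%N%:Z => p pf.
apply/setP=> x; rewrite inE; apply: (subsetP (filtration_mono _)).
  2: exact: (svalP (cid (HX.2 x))).
by apply: le_trans pf; rewrite -/(f x) (bigD1 x) //=; lia.
Qed.

Definition chain_filt p n : zmodClosed (C n) := supp_in false [set: T] n (X p).

Lemma chain_filt_mono p p' n c :
  p <= p' -> c \in chain_filt p n -> c \in chain_filt p' n.
Proof. by move=> pp; apply: supp_in_mono; apply: filtration_mono. Qed.

Lemma chain_filt_neg p n c : p <= -1 -> c \in chain_filt p n -> c = 0.
Proof.
by move=> p1; rewrite /chain_filt (filtration_neg p1); apply: supp_in_set0.
Qed.

Definition poset_ss : spectral_sequence :=
  filtered_ss (d := d) (F := chain_filt)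
    (@bd_bd _ _ false [set: T]) chain_filt_mono.

Lemma poset_ss_converges : converges_to poset_ss (Hf [set: T]).
Proof.
have [hi hiP] := filtration_top.
apply: (@filtered_ss_converges _ _ _ _ _ (-1) hi) => p n c.
  exact: chain_filt_neg.
by move=> /hiP Xp; apply/supp_inP=> s _; rewrite Xp subsetT.
Qed.

Lemma diff_class r p q p' q' (Hp : p' = p - r%:Z) (Hq : q' = q + r%:Z - 1) z :
  diff poset_ss (r := r) (p := p) (q := q) Hp Hq (subquot_class _ z)
  = subquot_class _ (drcycle chain_filt (@bd_bd _ _ false [set: T]) Hp Hq z).
Proof. exact: EdiffE. Qed.

Lemma page_class r p q (e : page poset_ss r p q) :
  exists z, e = subquot_class _ z.
Proof. exact: subquot_class_surj. Qed.

Section Theta.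
Variables p n : int.
Hypothesis p1 : 1 <= p.
Local Notation A := (X p).
Local Notation Z1 := (rcycle d chain_filt 1 p n).
Local Notation B1 := (rboundary d chain_filt 1 p n).
Let A'A : X (p - 1) \subset A. Proof. by apply: filtration_mono; lia. Qed.
Let anti : is_antichain (stratum X p). Proof. exact: HA.2. Qed.
Let CA x : x \in stratum X p -> Chat A x \subset X (p - 1).
Proof. exact: Chat_stratum. Qed.
Implicit Types i : {x | x \in stratum X p}.

Lemma link_cycle i (z : subgrp Z1) :
  link A (val i) (n - 1) (val z)
    \in ker_pred (bd true (Chat A (val i)) (n - 1) (n - 1 - 1)).
Proof.
have /andP[zA dz] := valP z; apply/eqP; rewrite bd_link //.
by rewrite (link_supp A'A _ _ dz) ?oppr0 //; apply: valP.
Qed.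

Definition link_cyc i :
    {additive subgrp Z1 -> cyc true (Chat A (val i)) (n - 1)} :=
  corestr (g := @link _ _ A (val i) _ n (n - 1) \o val) (link_cycle i).

Definition theta_rep :
    {additive subgrp Z1 -> dsum (fun i => Hred (Chat A (val i)) (n - 1))} :=
  dsum_map (fun i => subquot_class _ \o link_cyc i : {additive _ -> Hred _ _}).

Lemma theta_rep0 z : val z \in B1 -> theta_rep z = 0.
Proof.
case/(rboundaryP _ _ _ _ _ erefl)=> a [b [aF bF zE]].
apply: dsum_ext => i; rewrite dsum_mapE [RHS]ffunE.
apply/subquot_class_eq0/asboolP; exists (- link A (val i) (n - 1 + 1) b).
rewrite raddfN bd_link ?opprK //; first last.
- by move: bF; rewrite /chain_filt addrK.
- by rewrite addrK.
- by rewrite addrAC.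
by rewrite /= zE raddfD /= (link_supp A'A _ (valP i) aF) ?add0r // addrK.
Qed.

(** If link_i z = d b_i for all i, then the sum B of the cones over the b_i has
    boundary (the sum of the b_i) - (the sum of the cones over the link_i z).
    So z + d B is, modulo F_(p-1), the difference of z and of its total cone,
    which lies in F_(p-1). *)
Lemma theta_rep_inj z : theta_rep z = 0 -> val z \in B1.
Proof.
move=> z0; have h i : exists b : chains true (Chat A (val i)) n,
    bd true _ n (n - 1) b = link A (val i) (n - 1) (val z).
  have /subquot_class_eq0/asboolP[] : subquot_class (im_pred
      (bd true (Chat A (val i)) (n - 1 + 1) (n - 1))) (link_cyc i z) = 0.
    by rewrite -[LHS](dsum_mapE (fun i => subquot_class _ \o link_cyc i
         : {additive _ -> Hred _ _})) -/theta_rep z0 /dsum_coord ffunE.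
  by rewrite addrNK => b bE; exists b.
pose b i := sval (cid (h i)).
have bE i : bd true _ n (n - 1) (b i) = link A (val i) (n - 1) (val z).
  exact: svalP (cid (h i)).
have /andP[zA _] := valP z.
apply/(rboundaryP _ _ _ _ _ erefl).
exists (val z - tcone n (fun i => link A (val i) (n - 1) (val z))
        + \sum_i push false _ n (b i)), (- tcone (n + 1) b).
split.
- rewrite rpredD //; last exact: sum_push_supp.
  by apply: sub_tcone_supp => //; rewrite addrNK.
- by rewrite rpredN /chain_filt addrK; apply: tcone_supp.
have tE : tcone n (fun i => bd true _ n (n - 1) (b i))
    = tcone n (fun i => link A (val i) (n - 1) (val z)).
  by apply: eq_bigr => i _; rewrite bE.
by rewrite raddfN (bd_tcone _ _ erefl) // tE opprB addrACA subrK subrr addr0.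
Qed.

Lemma tcone_rcycle (sigma : forall i, cyc true (Chat A (val i)) (n - 1)) :
  tcone n (fun i => cyc_val (sigma i)) \in Z1.
Proof.
have nm : n = n - 1 + 1 by rewrite subrK.
apply/andP; split; first exact: tcone_supp.
by rewrite bd_tcone_cycles //; apply: sum_push_supp.
Qed.

Lemma theta_rep_tcone sigma i :
  dsum_coord (theta_rep (Subgrp (tcone_rcycle sigma))) i = class (sigma i).
Proof.
rewrite dsum_mapE; congr subquot_class; apply/val_inj => /=.
by rewrite link_tcone ?subrK.
Qed.

(** The map is characterised on representatives, so that its value can be
    computed from any cycle equal to the link. *)
Lemma theta_exists :
  exists th : {additive subquot Z1 B1 ->
                 dsum (fun i => Hred (Chat A (val i)) (n - 1))},
  bijective th /\
  forall z i (sigma : cyc true (Chat A (val i)) (n - 1)),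
    cyc_val sigma = link A (val i) (n - 1) (val z) ->
    dsum_coord (th (subquot_class _ z)) i = class sigma.
Proof.
exists (subquot_lift theta_rep0); split.
  apply: subquot_lift_bij theta_rep_inj _ => u.
  pose h i := subquot_class_surj (dsum_coord u i).
  pose sigma i : cyc true (Chat A (val i)) (n - 1) := sval (cid (h i)).
  exists (Subgrp (tcone_rcycle sigma)); apply: dsum_ext => i.
  rewrite theta_rep_tcone; exact: esym (svalP (cid (h i))).
move=> z i sigma E; rewrite subquot_liftE dsum_mapE.
by congr subquot_class; apply/val_inj.
Qed.
End Theta.

(** As F_(-1) = 0, the 1-cycles in F_0 are the cycles of X_0, up to the
    identification of chains of X_0 with chains of X supported in X_0. *)
Lemma theta0_exists n n' : n = n' ->
  exists th : {additive subquot (rcycle d chain_filt 1 0 n)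
                                (rboundary d chain_filt 1 0 n) -> Hf (X 0) n'},
  bijective th /\
  forall z (sigma : cyc false (X 0) n'),
    cyc_val sigma = push false (X 0) n' (val z) ->
    th (subquot_class _ z) = class sigma.
Proof.
move=> <- {n'}.
set Z1 := rcycle _ _ _ _ _; set B1 := rboundary _ _ _ _ _.
have pushK m (c : C m) : c \in chain_filt 0 m ->
    push false [set: T] m (push false (X 0) m c) = c.
  move=> cF; rewrite push_push ?push_id // => s g cs.
  exact: is_gen_in g (elimT (supp_inP c) cF s cs).
have pushK' m (c : chains false (X 0) m) :
    push false (X 0) m (push false [set: T] m c) = c.
  rewrite push_push ?push_id // => s g _.
  exact: is_gen_in g (subsetT s).
have bdp m m' (c : C m) : m' = m - 1 -> c \in chain_filt 0 m ->
    bd false (X 0) m m' (push false (X 0) m c) = push false (X 0) m' (d m m' c).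
  by move=> mm cF; apply: bd_push.
have zcyc (z : subgrp Z1) :
    push false (X 0) n (val z) \in ker_pred (bd false (X 0) n (n - 1)).
  have /andP[zF /chain_filt_neg dz] := valP z.
  by apply/eqP; rewrite bdp // dz ?raddf0.
pose f : {additive subgrp Z1 -> Hf (X 0) n} :=
  subquot_class _ \o corestr (g := @push _ T _ _ _ false (X 0) n \o val) zcyc.
have f0 z : val z \in B1 -> f z = 0.
  case/(rboundaryP _ _ _ _ _ erefl)=> a [b [/chain_filt_neg aF bF zE]].
  apply/subquot_class_eq0/asboolP; exists (push false (X 0) (n + 1) b).
  by rewrite /= bdp ?addrK // zE aF ?add0r.
exists (subquot_lift f0); split; last first.
  move=> z sigma E; rewrite subquot_liftE; congr subquot_class.
  exact: val_inj.
apply: subquot_lift_bij => [z /subquot_class_eq0/asboolP[b bE]|h].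
  have {}bE : bd false (X 0) (n + 1) n b = push false (X 0) n (val z) := bE.
  have /andP[zF _] := valP z.
  apply/(rboundaryP _ _ _ _ _ erefl).
  exists 0, (push false [set: T] (n + 1) b).
  rewrite rpred0; split=> //; first by rewrite addrK; apply: push_supp.
  rewrite add0r bd_push ?addrK // ?bE ?pushK //; exact: supp_in_setT.
have [sigma ->] := subquot_class_surj h.
have zZ : push false [set: T] n (val sigma) \in Z1.
  apply/andP; split; first exact: push_supp.
  rewrite bd_push ?supp_in_setT //.
  by rewrite (eqP (valP sigma)) raddf0 rpred0.
exists (Subgrp zZ); congr subquot_class; apply/val_inj; exact: pushK'.
Qed.
End AntichainFiltration.

Theorem theorem3p7 (disp : Order.disp_t) (T : finPOrderType disp)
    (X : int -> {set T}) (HX : is_filtration X)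
    (HA : induced_by_antichains X) :
  exists (S : spectral_sequence)
    (theta0 : forall q : int, {additive page S 1 0 q -> Hf (X 0) q})
    (theta : forall p q : int,
       {additive page S 1 p q ->
         dsum (fun x : {x | x \in stratum X p} =>
                 Hred (Chat (X p) (val x)) (p + q - 1))}),
  converges_to S (Hf [set: T]) /\
  (forall p q : int, p <= -1 -> forall e : page S 1 p q, e = 0) /\
  (forall q : int, bijective (theta0 q)) /\
  (forall p q : int, 1 <= p -> bijective (theta p q)) /\
  (forall (p q p' q' : int) (Hp : p' = p - 1%:Z) (Hq : q' = q + 1%:Z - 1),
     p <= 0 -> forall e : page S 1 p q, diff S Hp Hq e = 0) /\
  (forall (q q' : int) (Hp : 0 = 1 - 1%:Z) (Hq : q' = q + 1%:Z - 1),
     0 <= q ->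
     forall (e : page S 1 1 q)
       (sigma : forall x : {x | x \in stratum X 1},
          cyc true (Chat (X 1) (val x)) (1 + q - 1)),
     (forall x, dsum_coord (theta 1 q e) x = class (sigma x)) ->
     exists tau : {x | x \in stratum X 1} -> cyc false (X 0) q',
       (forall x, cyc_val (tau x) = push false (X 0) q' (cyc_val (sigma x))) /\
       theta0 q' (diff S Hp Hq e) = \sum_x class (tau x)) /\
  (forall (p q p' q' : int) (Hp : p' = p - 1%:Z) (Hq : q' = q + 1%:Z - 1),
     1 <= p -> q <= - p -> forall e : page S 1 p q, diff S Hp Hq e = 0) /\
  (forall (p q p' q' : int) (Hp : p' = p - 1%:Z) (Hq : q' = q + 1%:Z - 1),
     2 <= p -> 1 - p <= q ->
     forall (e : page S 1 p q)
       (l : {x | x \in stratum X p} -> nat)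
       (a : forall x, 'I_(l x) -> int)
       (s : forall x, 'I_(l x) ->
          gens true (Chat (X p) (val x)) (p + q - 1))
       (sigma : forall x, cyc true (Chat (X p) (val x)) (p + q - 1)),
     (forall x, cyc_val (sigma x) =
        \sum_(i < l x) gen true (Chat (X p) (val x)) (p + q - 1)
                         (val (s x i)) *~ a x i) ->
     (forall x, dsum_coord (theta p q e) x = class (sigma x)) ->
     exists tau : forall y : {y | y \in stratum X p'},
         cyc true (Chat (X p') (val y)) (p' + q' - 1),
       (forall y, cyc_val (tau y) =
          \sum_x \sum_(i < l x | val y \in val (s x i))
             gen true (Chat (X p') (val y)) (p' + q' - 1)
                 (val (s x i) :\ val y)
               *~ (a x i * sgn (val (s x i)) (val y))) /\
       (forall y, dsum_coord (theta p' q' (diff S Hp Hq e)) y =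
                  class (tau y))).
Proof.
pose S := poset_ss HX.
have th0 q := theta0_exists HX HA (add0r q).
pose theta0 q := sval (cid (th0 q)).
(* For p <= 0 the type of theta still has to be inhabited; 0 will do. *)
have th p q : exists th : {additive page S 1 p q ->
      dsum (fun x : {x | x \in stratum X p} =>
              Hred (Chat (X p) (val x)) (p + q - 1))},
    1 <= p -> bijective th /\
    forall z (i : {x | x \in stratum X p})
        (sigma : cyc true (Chat (X p) (val i)) (p + q - 1)),
      cyc_val sigma = link (X p) (val i) (p + q - 1) (val z) ->
      dsum_coord (th (subquot_class _ z)) i = class sigma.
  case: (leP 1 p) => [p1|_]; last by exists \0.
  by have [f fP] := theta_exists HX HA (p + q) p1; exists f.
pose theta p q := sval (cid (th p q)).
have thP p q : 1 <= p -> _ := svalP (cid (th p q)).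
have page_neg p q (e : page S 1 p q) : p <= -1 -> e = 0.
  move=> p1; have [z ->] := page_class e.
  have /andP[zF _] := valP z.
  by apply/subquot_class_eq0; rewrite (chain_filt_neg HX HA p1 zF) rpred0.
(* For p >= 1, every class of E^1_p has a total cone as representative. *)
have lift p q (e : page S 1 p q) sigma : 1 <= p ->
    (forall x, dsum_coord (theta p q e) x = class (sigma x)) ->
    exists2 z, e = subquot_class _ z
             & val z = tcone (p + q) (fun i => cyc_val (sigma i)).
  move=> p1 eE; have [thbij thE] := thP p q p1.
  exists (Subgrp (tcone_rcycle HX HA p1 sigma)) => //.
  apply: (bij_inj thbij); apply: dsum_ext => i; rewrite [LHS]eE.
  apply/esym/thE; rewrite /= link_tcone ?subrK //.
    by apply: filtration_mono => //; lia.
  by move=> x; apply: Chat_stratum.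
exists S, theta0, theta.
split; first exact: poset_ss_converges.
split; first by move=> p q p1 e; apply: page_neg.
split; first by move=> q; case: (svalP (cid (th0 q))).
split; first by move=> p q p1; case: (thP p q p1).
split.
  by move=> p q p' q' Hp Hq p0 e; apply: page_neg; lia.
split.
  move=> q q' Hp Hq q0 e sigma eE.
  have q'E : q' = 1 + q - 1 by lia.
  have Csub x : x \in stratum X 1 -> Chat (X 1) x \subset X 0.
    exact: Chat_stratum.
  pose tau (x : {x | x \in stratum X 1}) : cyc false (X 0) q' :=
    Subgrp (push_cycle (aug' := false) (sigma x) q'E isT (Csub _ (valP x))).
  exists tau; split=> //.
  have [z -> zE] := lift 1 q e sigma isT eE.
  rewrite diff_class -raddf_sum; apply: (svalP (cid (th0 q'))).2.
  rewrite val_drcycle zE bd_tcone_cycles; try lia.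
  rewrite /cyc_val raddf_sum.
  rewrite [RHS]raddf_sum; apply: eq_bigr => x _.
  rewrite [RHS]push_push // => t g _; rewrite add0r.
  exact: is_gen_in g (subsetT t).
split.
  move=> p q p' q' Hp Hq p1 qp e.
  have [z ->] := page_class (diff S Hp Hq e).
  by apply/subquot_class_eq0; rewrite [val z]chains_neg ?rpred0 //; lia.
move=> p q p' q' Hp Hq p2 q1 e l a s sigma sE eE.
have p1 : 1 <= p by lia.
have p'1 : 1 <= p' by lia.
have [z -> zE] := lift p q e sigma p1 eE.
rewrite diff_class; set dz := drcycle _ _ _ _ z.
pose tau y := link_cyc HX (p' + q') p'1 y dz.
exists tau; split; last by move=> y; apply: (thP p' q' p'1).2.
move=> y; have -> : cyc_val (tau y)
    = link (X p') (val y) (p' + q' - 1) (val dz) by [].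
rewrite val_drcycle zE bd_tcone_cycles; try lia.
rewrite raddf_sum; apply: eq_bigr => x _; rewrite sE [RHS]big_mkcond.
rewrite (raddf_sum (@push _ T _ _ _ false [set: T] (p' + q'))) [LHS]raddf_sum.
apply: eq_bigr => i _; rewrite !raddfMz.
have g : is_gen true (Chat (X p) (val x)) (p + q - 1) (val (s x i)).
  exact: valP (s x i).
rewrite /= push_gen // link_gen; last first.
  rewrite (_ : p' + q' = p + q - 1); last lia.
  apply: (is_gen_mono g (subsetT _)); rewrite -cards_eq0.
  by move: (is_gen_card g); case: #|_| => [|k] //=; lia.
case: ifP => _; last by rewrite mul0rz.
by rewrite mulrC mulrzA.
Qed.
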